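(* Let $C_n$ be a directed cycle with all edge labels the same. Let $m$ be the number of edges which have opposite standard orientation. Let $\mathfrak{a}$ denote the abelian factor of the associated Lie algebra $\mathfrak{n}_{C_n}$. (1) If $n=2k$ is even and $m$ is odd, then the dimension of $\mathfrak{a}$ is zero. (2) If $n=2k$ is even and $m$ is even, then the dimension of $\mathfrak{a}$ is $2$, and for some choice of signs $\epsilon_j=\pm1$ a basis is $\left\{\sum_{i=1}^{k}\epsilon_{2i-1}v_{2i-1},\ \sum_{i=1}^{k}\epsilon_{2i}v_{2i}\right\}$. (3) If $n=2k+1$ is odd, then the dimension of $\mathfrak{a}$ is $1$, and for some choice of signs $\epsilon_i=\pm1$ a basis is $\left\{\sum_{i=1}^{n}\epsilon_i v_i\right\}$.
   Context: A directed edge-labeled graph $G=(V,E,C)$ is a finite connected directed graph with vertex set $V=\{v_1,\dots,v_n\}$ and edge set $E$, together with a surjective labeling $c:E\to C=\{Z_1,\dots,Z_p\}$ (labels may be repeated on different edges). An edge directed from $v$ to $w$ is written $(v,w)$. The Lie algebra $\mathfrak{n}_G$: as a real vector space $\mathfrak{n}_G=\mathfrak{v}\oplus\mathfrak{w}$, where $\mathfrak{v}$ has basis $V$ and $\mathfrak{w}$ has basis $C$. The bracket is bilinear and skew-symmetric with $[v_i,v_j]=\sum_{\ell}(\epsilon_\ell-\epsilon'_\ell)Z_\ell$, where $\epsilon_\ell=1$ if $c(v_i,v_j)=Z_\ell$ and $0$ otherwise, and $\epsilon'_\ell=1$ if $c(v_j,v_i)=Z_\ell$ and $0$ otherwise (these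 coefficients are unrelated to the signs in the claim); all other brackets of basis elements are zero. For a simple graph the derived algebra is $[\mathfrak{n}_G,\mathfrak{n}_G]=\mathfrak{w}$. The abelian factor of $\mathfrak{n}_G$ is the unique subspace $\mathfrak{a}\subseteq\mathfrak{v}$ such that the center satisfies $\mathcal{Z}(\mathfrak{n}_G)=[\mathfrak{n}_G,\mathfrak{n}_G]\oplus\mathfrak{a}$. $C_n$ ($n\ge 3$) is the cycle with vertices $v_1,\dots,v_n$ and $n$ edges, $v_i$ adjacent to $v_{i+1}$ for $1\le i\le n-1$ and $v_n$ adjacent to $v_1$, each edge given some direction. An edge has standard orientation if it is directed as $(v_i,v_{i+1})$, $1\le i\le n-1$, or $(v_n,v_1)$; it has opposite standard orientation if it is directed as $(v_{i+1},v_i)$, $1\le i\le n-1$, or $(v_1,v_n)$. *)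

(* Defs.v *)
From HB Require Import structures.
From mathcomp Require Import all_boot all_order all_algebra.
From mathcomp Require Import reals.

Set Implicit Arguments.
Unset Strict Implicit.
Unset Printing Implicit Defensive.

Import Order.TTheory GRing.Theory Num.Theory.
Local Open Scope ring_scope.

(* Connectedness is that of the underlying undirected graph.  The labeling is
   only defined on the edges, so that surjectivity is about genuine edges. *)
Record edge_labeled_graph (V C : finType) := EdgeLabeledGraph {
  edges : {set V * V};
  label : {e : V * V | e \in edges} -> C;
  graph_connected : forall x y : V,
    connect (fun u v => ((u, v) \in edges) || ((v, u) \in edges)) x y;
  label_surj : forall Z : C, exists e, label e = Z
}.

Definition simple_graph (V C : finType) (G : edge_labeled_graph V C) : Prop :=
  forall x y : V, (x, y) \in edges G -> (y, x) \notin edges G.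

Definition same_labels (V C : finType) (G : edge_labeled_graph V C) : Prop :=
  forall e f : {e : V * V | e \in edges G}, label e = label f.

Definition graph_lie (R : realType) (V C : finType) : vectType R :=
  ({ffun V -> R^o} * {ffun C -> R^o})%type.

Section LieAlgebra.
Variables (R : realType) (V C : finType).
Implicit Types (G : edge_labeled_graph V C).

Definition vvec (x : V) : graph_lie R V C := ([ffun y => (y == x)%:R], 0).
Definition wvec (Z : C) : graph_lie R V C := (0, [ffun Z' => (Z' == Z)%:R]).

Definition vpart : {vspace graph_lie R V C} := <<[seq vvec x | x <- enum V]>>%VS.

Definition has_label G (x y : V) (Z : C) : bool :=
  [exists e : {e : V * V | e \in edges G}, (val e == (x, y)) && (label e == Z)].

Definition basis_bracket G (x y : V) : graph_lie R V C :=
  \sum_(Z : C) ((has_label G x y Z)%:R - (has_label G y x Z)%:R) *: wvec Z.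

(* Bilinear extension; brackets involving a vector of w vanish, so only the
   v-components contribute. *)
Definition bracket G (a b : graph_lie R V C) : graph_lie R V C :=
  \sum_(x : V) \sum_(y : V) (a.1 x * b.1 y) *: basis_bracket G x y.

Definition is_center G (Z : {vspace graph_lie R V C}) : Prop :=
  forall a, a \in Z <-> (forall b, bracket G a b = 0).

(* The linear span of all brackets, as the least subspace containing them. *)
Definition is_derived G (D : {vspace graph_lie R V C}) : Prop :=
  (forall a b, bracket G a b \in D) /\
  (forall U : {vspace graph_lie R V C},
     (forall a b, bracket G a b \in U) -> (D <= U)%VS).

Definition is_abelian_factor G (A : {vspace graph_lie R V C}) : Prop :=
  (A <= vpart)%VS /\
  exists Z D : {vspace graph_lie R V C},
    [/\ is_center G Z, is_derived G D, Z = (D + A)%VS & directv (D + A)].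

Fact bracket_is_linear_l G b : linear (bracket G ^~ b).
Proof.
move=> k a a'; rewrite /bracket scaler_sumr -big_split; apply: eq_bigr => x _.
rewrite scaler_sumr -big_split; apply: eq_bigr => y _ /=.
by rewrite scalerA -scalerDl !ffunE [k *: _]/GRing.scale /= mulrDl mulrA.
Qed.

Fact bracket_is_linear_r G a : linear (bracket G a).
Proof.
move=> k b b'; rewrite /bracket scaler_sumr -big_split; apply: eq_bigr => x _.
rewrite scaler_sumr -big_split; apply: eq_bigr => y _ /=.
rewrite scalerA -scalerDl !ffunE [k *: _]/GRing.scale /= mulrDr.
by rewrite mulrCA.
Qed.

Fact bracketC G a b : bracket G a b = - bracket G b a.
Proof.
rewrite /bracket exchange_big -sumrN; apply: eq_bigr => x _.
rewrite -sumrN; apply: eq_bigr => y _; rewrite mulrC -scalerN; congr (_ *: _).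
by rewrite /basis_bracket -sumrN; apply: eq_bigr => Z _; rewrite -scaleNr opprB.
Qed.

Fact bracket_vvec G x y : bracket G (vvec x) (vvec y) = basis_bracket G x y.
Proof.
rewrite /bracket (bigD1 x) //= (bigD1 y) //= !ffunE !eqxx mulr1 scale1r.
rewrite big1 => [|z zy]; last by rewrite !ffunE (negPf zy) mulr0 scale0r.
rewrite big1 ?addr0 // => z zx; apply: big1 => t _.
by rewrite !ffunE (negPf zx) mul0r scale0r.
Qed.

Fact basis_bracket1 G x y : (basis_bracket G x y).1 = 0.
Proof.
rewrite /basis_bracket (raddf_sum (@fst _ _)) big1 // => Z _ /=.
exact: scaler0.
Qed.

Fact bracket1 G a b : (bracket G a b).1 = 0.
Proof.
rewrite /bracket (raddf_sum (@fst _ _)) big1 // => x _ /=.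
rewrite (raddf_sum (@fst _ _)) big1 // => y _ /=.
by rewrite basis_bracket1 scaler0.
Qed.

(* All double brackets vanish, so the Jacobi identity is trivial. *)
Fact bracket_2step G a b c : bracket G a (bracket G b c) = 0.
Proof.
rewrite {1}/bracket big1 // => x _; rewrite big1 // => y _.
by rewrite bracket1 ffunE mulr0 scale0r.
Qed.

Fact graph_lie_eq (a b : graph_lie R V C) : a.1 = b.1 -> a.2 = b.2 -> a = b.
Proof. by case: a b => [? ?] [? ?] /= -> ->. Qed.

Fact vpart_mem a : (a \in vpart) = (a.2 == 0).
Proof.
apply/idP/eqP => [/coord_span-> | a2].
  rewrite (raddf_sum (@snd _ _)) big1 // => i _ /=.
  have : [seq vvec x | x <- enum V]`_i \in [seq vvec x | x <- enum V].
    by rewrite mem_nth // size_map -cardE ltn_ord.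
  by case/mapP=> x _ ->; rewrite /= scaler0.
have -> : a = \sum_(x : V) a.1 x *: vvec x.
  apply: graph_lie_eq; last first.
    by rewrite a2 (raddf_sum (@snd _ _)) big1 // => i _ /=; rewrite scaler0.
  rewrite (raddf_sum (@fst _ _)); apply/ffunP => x.
  rewrite sum_ffunE (bigD1 x) //= big1 => [|y yx]; rewrite !ffunE.
    by rewrite eqxx addr0 [_ *: _]mulr1.
  by rewrite eq_sym (negPf yx) scaler0.
apply: memv_suml => x _; apply/memvZ/memv_span/map_f.
by rewrite mem_enum.
Qed.

Fact derived_ex G : exists D : {vspace graph_lie R V C}, is_derived G D.
Proof.
exists <<[seq basis_bracket G x y | x <- enum V, y <- enum V]>>%VS; split.
  move=> a b; apply: memv_suml => x _; apply: memv_suml => y _.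
  apply/memvZ/memv_span/allpairs_f; exact: mem_enum.
move=> U UP; apply/span_subvP => _ /allpairsP[p [_ _ ->]].
by rewrite -bracket_vvec.
Qed.

Fact derived_mem G D : simple_graph G -> is_derived G D ->
  forall a, (a \in D) = (a.1 == 0).
Proof.
move=> sG [DP Dmin] a.
have wD Z : wvec Z \in D.
  have [[[x y] xyE] <-] := @label_surj _ _ G Z.
  have := DP (vvec x) (vvec y); rewrite bracket_vvec /basis_bracket.
  rewrite (bigD1 (label (exist _ (x, y) xyE))) //=.
  have -> : has_label G x y (label (exist _ (x, y) xyE)).
    by apply/existsP; exists (exist _ (x, y) xyE); rewrite !eqxx.
  have nyx Z' : has_label G y x Z' = false.
    apply/existsP => -[[e eE] /andP[/= /eqP eyx _]].
    by move: (sG _ _ xyE); rewrite -eyx eE.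
  rewrite nyx subr0 scale1r big1 ?addr0 // => Z' neZ.
  rewrite nyx subr0 /has_label; case: existsP => [[[e eE] /andP[/= /eqP exy /eqP lZ]]|_].
    case/eqP: neZ; rewrite -lZ; congr label; exact: val_inj.
  by rewrite scale0r.
apply/idP/eqP => [aD | a1].
  pose p := linfun (@fst {ffun V -> R^o} {ffun C -> R^o}).
  have /subvP/(_ _ aD) : (D <= lker p)%VS.
    by apply: Dmin => b c; rewrite memv_ker lfunE /= bracket1.
  by rewrite memv_ker lfunE => /eqP.
have -> : a = \sum_(Z : C) a.2 Z *: wvec Z.
  apply: graph_lie_eq.
    by rewrite a1 (raddf_sum (@fst _ _)) big1 // => i _ /=; rewrite scaler0.
  rewrite (raddf_sum (@snd _ _)); apply/ffunP => x.
  rewrite sum_ffunE (bigD1 x) //= big1 => [|y yx]; rewrite !ffunE.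
    by rewrite eqxx addr0 [_ *: _]mulr1.
  by rewrite eq_sym (negPf yx) scaler0.
by apply: memv_suml => Z _; apply: memvZ.
Qed.

Fact center_ex G : exists Z : {vspace graph_lie R V C}, is_center G Z.
Proof.
pose ad (b : graph_lie R V C) : {linear graph_lie R V C -> graph_lie R V C} :=
  HB.pack (bracket G ^~ b)
    (GRing.isLinear.Build _ _ _ _ _ (bracket_is_linear_l G b)).
exists (\bigcap_(y : V) lker (linfun (ad (vvec y))))%VS => a; split.
  move=> aZ b; rewrite /bracket exchange_big big1 // => y _.
  have : a \in lker (linfun (ad (vvec y))).
    by move: aZ; apply/subvP; apply: (bigcapv_inf y).
  rewrite memv_ker lfunE /= /bracket => /eqP H.
  transitivity (b.1 y *: \sum_(x : V) a.1 x *: basis_bracket G x y).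
    rewrite scaler_sumr; apply: eq_bigr => x _.
    by rewrite scalerA mulrC.
  suff -> : \sum_(x : V) a.1 x *: basis_bracket G x y = 0 by rewrite scaler0.
  rewrite -[RHS]H; apply: eq_bigr => x _.
  rewrite (bigD1 y) //= big1 => [|z zy]; rewrite !ffunE.
    by rewrite eqxx mulr1 addr0.
  by rewrite (negPf zy) mulr0 scale0r.
move=> aZ; rewrite memvE; apply/subv_bigcapP => y _; rewrite -memvE.
by rewrite memv_ker lfunE /= aZ.
Qed.

(* The intrinsic description of the abelian factor is meaningful: for simple
   graphs there is exactly one such subspace. *)
Lemma abelian_factor_exists_unique G : simple_graph G ->
  exists! A : {vspace graph_lie R V C}, is_abelian_factor G A.
Proof.
move=> sG; have [D DP] := derived_ex G; have [Z ZP] := center_ex G.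
have Dm := derived_mem sG DP.
have DV : (D :&: vpart = 0)%VS.
  apply/eqP; rewrite -subv0; apply/subvP => a.
  rewrite memv_cap Dm vpart_mem memv0 => /andP[/eqP a1 /eqP a2].
  by apply/eqP; apply: graph_lie_eq.
have DZ : (D <= Z)%VS.
  apply/subvP => a; rewrite Dm => /eqP a1; apply/ZP => b.
  rewrite /bracket big1 // => x _; rewrite big1 // => y _.
  by rewrite a1 ffunE mul0r scale0r.
have DvT : (D + vpart = fullv)%VS.
  apply/eqP; rewrite eqEsubv subvf /=; apply/subvP => a _.
  have -> : a = (0, a.2) + (a.1, 0).
    by apply: graph_lie_eq; rewrite /= ?add0r ?addr0.
  by apply: memv_add; rewrite ?Dm ?vpart_mem eqxx.
exists (Z :&: vpart)%VS; split.
  split; first exact: capvSr.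
  exists Z, D; split=> //.
    by rewrite capvC vspace_modl // ?DvT ?capfv // capvC.
  apply/directv_addP/eqP; rewrite -subv0 -DV; apply: capvS => //.
  exact: capvSr.
move=> A [Av [Z' [D' [ZP' [D'b D'min] eZ' dir]]]].
have eD : D' = D.
  case: DP => Db Dmin; apply/eqP; rewrite eqEsubv.
  by rewrite D'min // Dmin.
have eZ : Z' = Z.
  by apply/vspaceP => a; apply/idP/idP => [/ZP'/ZP|/ZP/ZP'].
rewrite -eZ eZ' eD addvC capvC (addvC A) -vspace_modr // capvC DV add0v.
by [].
Qed.

End LieAlgebra.

(* The vertex v_i, 1 <= i <= n, is the ordinal i - 1; ordS is the cyclic
   successor.  Opposite edges (w, v) are those with w the successor of v. *)
Definition directed_cycle (n : nat) (C : finType)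
    (G : edge_labeled_graph 'I_n C) : Prop :=
  (forall x y : 'I_n, (x, y) \in edges G -> y = ordS x \/ x = ordS y) /\
  (forall x : 'I_n, ((x, ordS x) \in edges G) (+) ((ordS x, x) \in edges G)).

Definition num_opposite (n : nat) (C : finType)
    (G : edge_labeled_graph 'I_n C) : nat :=
  #|[set e in edges G | e.1 == ordS e.2]|.

Fact directed_cycle_simple (n : nat) (C : finType)
  (G : edge_labeled_graph 'I_n C) : directed_cycle G -> simple_graph G.
Proof.
move=> [adj xorG] x y xy; apply/negP => yx.
by case: (adj _ _ xy) => e; [have := xorG x | have := xorG y];
  rewrite -e xy yx.
Qed.

(* Main.v *)
Require Import Defs.
From mathcomp Require Import all_boot all_order all_algebra.
From mathcomp Require Import reals.

Set Implicit Arguments.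
Unset Strict Implicit.
Unset Printing Implicit Defensive.

Import Order.TTheory GRing.Theory Num.Theory.
Local Open Scope ring_scope.

(** The abelian factor consists of the central vectors supported on the
vertices, and such a vector [a] is central exactly when it satisfies, around
the cycle, the recurrence [s_x a_x = s_(x+1) a_(x+2)], where [s_x] is [1] or
[-1] according to whether the edge between [x] and [x+1] has the standard
orientation or not: the difference of the two sides is the coefficient of the
unique label in the bracket of [a] with the vertex [x+1]
([cycle_bracket_coef]).

The signs are removed by a change of variables.  Unroll the cycle to the natural
numbers and let [flips k] be the number of opposite edges among the first [k]
ones.  For [c_k = (-1)^(flips k) a_k] the recurrence becomes [c_(k+2) = c_k],
and the only trace of the signs is the monodromy: a full turn meets all [m]
opposite edges, so the [n]-periodicity of [a] becomes [c_(k+n) = (-1)^m c_k].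
Hence [c] is a function of the parity of [k], that is, a pair of numbers
[(c_0, c_1)], subject to this one closing condition ([cycle_factorP]).

If [n] is even, the closing condition reads [c_b = (-1)^m c_b]: it forces
[c = 0] when [m] is odd and is void when [m] is even, leaving [c_0] and [c_1]
free, each spanning the signed sums over the vertices of one parity.  If [n] is
odd, the condition exchanges the two parities and amounts to
[c_1 = (-1)^m c_0], which leaves a line spanned by a signed sum over all
vertices. *)

(** * Central vectors supported on the vertices *)

(** The derived algebra is the whole span of the labels, so taking vertex
components in [Z = D + A] does not leave [A].  By bilinearity it is enough to
test centrality on the vertices. *)
Lemma abelian_factorP (R : realType) (V C : finType)
    (G : edge_labeled_graph V C) (A : {vspace graph_lie R V C}) :
  simple_graph G -> is_abelian_factor G A ->
  forall a, a \in A <-> a.2 = 0 /\ (forall y, bracket G a (vvec R C y) = 0).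
Proof.
move=> sG [Av [Z [D [ZP DP eZ _]]]] a.
have Dm := derived_mem sG DP.
split=> [aA | [a2 aC]].
  split; first by apply/eqP; rewrite -vpart_mem (subvP Av).
  move=> y; move: (vvec R C y); apply/ZP.
  by rewrite eZ; apply: subvP aA; apply: addvSr.
have : a \in Z.
  apply/ZP => b; rewrite /bracket exchange_big big1 // => y _.
  transitivity (b.1 y *: bracket G a (vvec R C y)); last by rewrite aC scaler0.
  rewrite scaler_sumr; apply: eq_bigr => x _.
  rewrite (bigD1 y) //= big1 => [|z zy]; rewrite !ffunE.
    by rewrite eqxx mulr1 addr0 scalerA mulrC.
  by rewrite (negPf zy) mulr0 scale0r.
rewrite eZ => /memv_addP[d dD [a' a'A eda]].
suff d0 : d = 0 by rewrite eda d0 add0r.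
have /eqP d1 : d.1 == 0 by rewrite -Dm.
have /eqP a'2 : a'.2 == 0 by rewrite -vpart_mem (subvP Av).
apply: graph_lie_eq => //.
by move: a2; rewrite eda /= a'2 addr0.
Qed.

(** As labels are surjective, equality of all labels of edges means that there
is a single label; every bracket is then governed by one scalar, which depends
only on adjacency. *)
Lemma bracket_same_labels (R : realType) (V C : finType)
    (G : edge_labeled_graph V C) (a : graph_lie R V C) (y : V) :
  same_labels G ->
  bracket G a (vvec R C y) =
  (0, [ffun=> \sum_x a.1 x *
                (((x, y) \in edges G)%:R - ((y, x) \in edges G)%:R)]).
Proof.
move=> sL.
have hasE u v Z : has_label G u v Z = ((u, v) \in edges G).
  apply/existsP/idP => [[[e eE] /andP[/= /eqP <- _]] // | uvE].
  exists (exist _ (u, v) uvE); rewrite eqxx /=; apply/eqP.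
  by have [f <-] := @label_surj _ _ G Z; apply: sL.
apply: graph_lie_eq; first exact: bracket1.
apply/ffunP => Z; rewrite /bracket (raddf_sum (@snd _ _)) sum_ffunE ffunE.
apply: eq_bigr => x _; rewrite (raddf_sum (@snd _ _)) sum_ffunE.
rewrite (bigD1 y) //= big1 => [|z zy]; rewrite !ffunE; last first.
  by rewrite (negPf zy) mulr0 [_ *: _]mul0r.
rewrite eqxx mulr1 addr0 [_ *: _]/GRing.scale /=; congr (_ * _).
rewrite /basis_bracket (raddf_sum (@snd _ _)) sum_ffunE (bigD1 Z) //= big1.
  by rewrite !ffunE eqxx addr0 !hasE [_ *: _]mulr1.
by move=> Z' Z'Z; rewrite !ffunE eq_sym (negPf Z'Z) [_ *: _]mulr0.
Qed.

(** * The recurrence around the cycle *)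

Definition opposite (n : nat) (C : finType) (G : edge_labeled_graph 'I_n C)
  (x : 'I_n) : bool := (ordS x, x) \in edges G.

(** A vertex brackets nontrivially only with its two neighbors.  With at least
three vertices these are distinct, so each neighbor contributes one signed
term. *)
Lemma cycle_bracket_coef (R : realType) (p : nat) (C : finType)
    (G : edge_labeled_graph 'I_p.+3 C) (a : 'I_p.+3 -> R) (x : 'I_p.+3) :
  directed_cycle G ->
  \sum_z a z * (((z, ordS x) \in edges G)%:R - ((ordS x, z) \in edges G)%:R) =
  (-1) ^+ opposite G x * a x
  - (-1) ^+ opposite G (ordS x) * a (ordS (ordS x)).
Proof.
move=> cG; have [adj xorG] := cG.
have neq : ordS (ordS x) != x.
  case: x => i lti; apply/eqP => /(congr1 val) /=.
  rewrite -addn1 modnDml addn1 => /eqP.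
  have -> : i.+2 = (i + 2)%N by rewrite addn2.
  by rewrite -[X in _ == X](modn_small lti) -[X in _ == X %[mod _]]addn0 eqn_modDl.
rewrite (bigD1 x) //= (bigD1 (ordS (ordS x))) //= big1 ?addr0; last first.
  move=> z /andP[zx zSSx].
  have [-> ->] : (z, ordS x) \in edges G = false /\ (ordS x, z) \in edges G = false.
    split; apply/negP => /adj[] e; move: zx zSSx;
      by rewrite -?(ordS_inj e) ?(ordS_inj (esym e)) ?e ?eqxx.
  by rewrite subrr mulr0.
have sgn y : (((y, ordS y) \in edges G)%:R - (opposite G y)%:R : R)
    = (-1) ^+ opposite G y.
  have := xorG y; rewrite /opposite.
  by case: (_ \in _); case: (_ \in _) => //= _; rewrite ?subr0 ?sub0r.
have := sgn x; rewrite {1}/opposite => ->.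
have := sgn (ordS x); rewrite {1}/opposite => <-.
by rewrite [X in X + _]mulrC -mulNr opprB mulrC [X in _ + X]mulrC (mulrC (a x)).
Qed.

(** * Removing the signs *)

(** Vertices are indexed by all natural numbers, modulo the length of the cycle,
so that going around several times makes sense and the total sign of one turn
can be read off. *)
Definition flips (p : nat) (C : finType) (G : edge_labeled_graph 'I_p.+1 C)
  (k : nat) : nat := \sum_(0 <= i < k) opposite G (inZp i).

Lemma ordS_inZp (p k : nat) : ordS (inZp k : 'I_p.+1) = inZp k.+1.
Proof. by apply: val_inj; rewrite /= -addn1 modnDml addn1. Qed.

Lemma flips_period (p : nat) (C : finType) (G : edge_labeled_graph 'I_p.+1 C) :
  flips G p.+1 = num_opposite G.
Proof.
rewrite /flips big_mkord /num_opposite.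
under eq_bigr do rewrite valZpK.
have injf : injective (fun x : 'I_p.+1 => (ordS x, x)) by move=> x y [].
rewrite -big_mkcond sum1_card -(card_imset _ injf).
apply: eq_card => -[u v]; rewrite !inE /=.
apply/imsetP/andP => [[x xo [-> ->]] | [uvE /eqP uv]]; first by rewrite eqxx.
by exists v; rewrite -?uv // /in_mem /= /opposite -uv.
Qed.

Lemma flipsD (p : nat) (C : finType) (G : edge_labeled_graph 'I_p.+1 C) k :
  flips G (k + p.+1) = (flips G k + num_opposite G)%N.
Proof.
rewrite (addnC k) /flips (big_cat_nat (n := p.+1)) ?leq_addr //=.
rewrite -[X in (X + _)%N]/(flips G p.+1) flips_period addnC; congr (_ + _)%N.
rewrite -{1}[p.+1]add0n big_addn addKn; apply: eq_bigr => i _.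
by congr (nat_of_bool (opposite G _)); apply: val_inj; rewrite /= modnDr.
Qed.

Lemma periodic_modn (T : Type) (n : nat) (f : nat -> T) :
  (forall k, f (k + n)%N = f k) -> forall k, f k = f (k %% n)%N.
Proof.
move=> fn k; rewrite {1}(divn_eq k n) addnC.
by elim: (k %/ n)%N => [|q <-]; rewrite ?addn0 // mulSnr addnA fn.
Qed.

(** The function [c] is the sign-corrected coordinate: the recurrence makes it
depend only on parity, and the condition on [c] is what remains of the
requirement that the coordinates agree after one turn. *)
Lemma cycle_factorP (R : realType) (p : nat) (C : finType)
    (G : edge_labeled_graph 'I_p.+3 C) (A : {vspace graph_lie R 'I_p.+3 C}) :
  directed_cycle G -> same_labels G -> is_abelian_factor G A ->
  forall a, a \in A <-> a.2 = 0 /\ exists c : bool -> R,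
    (forall b, c (b (+) odd p.+3) = (-1) ^+ num_opposite G * c b) /\
    (forall i, a.1 i = (-1) ^+ flips G i * c (odd i)).
Proof.
move=> cG sL fA a; have sG := directed_cycle_simple cG.
have sgnK k (x : R) : (-1) ^+ k * ((-1) ^+ k * x) = x.
  by rewrite mulrA -expr2 sqrr_sign mul1r.
have factP := abelian_factorP sG fA a.
pose v k : 'I_p.+3 := inZp k.
have vper k : v (k + p.+3)%N = v k by apply: val_inj; rewrite /= modnDr.
pose c k : R := (-1) ^+ flips G k * a.1 (v k).
have aE k : a.1 (v k) = (-1) ^+ flips G k * c k by rewrite /c sgnK.
have centralP : (forall y, bracket G a (vvec R C y) = 0) <->
                (forall k, c k.+2 = c k).
  (* A label is needed to extract the scalar equation from a vector one. *)
  have /existsP[Z0 _] : [exists Z : C, true].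
    have E0 e : e \in edges G -> [exists Z : C, true].
      by move=> eE; apply/existsP; exists (@label _ _ G (exist _ e eE)).
    by have := cG.2 ord0; case: (boolP (_ \in _)) => [/E0|_ /= /E0].
  have brE k : bracket G a (vvec R C (v k.+1)) =
      (0, [ffun=> (-1) ^+ flips G k.+1 * (c k - c k.+2)]).
    rewrite bracket_same_labels // /v -ordS_inZp.
    rewrite (cycle_bracket_coef _ _ cG) !ordS_inZp /c /v.
    congr (_, _); apply/ffunP => Z; rewrite !ffunE.
    rewrite /flips !big_nat_recr //= !exprD.
    set s := (-1) ^+ \sum_(_ <= _ < _) _.
    set t := (-1) ^+ opposite G (inZp k).
    rewrite mulrBr !mulrA; congr (_ - _).
      by rewrite [s * t]mulrC -[t * s * s]mulrA -expr2 /s sqrr_sign mulr1.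
    by rewrite [s * t * s]mulrAC -expr2 sqrr_sign mul1r -expr2 sqrr_sign mul1r.
  split=> [brac0 k | cper y].
    have := congr1 (fun u : graph_lie R 'I_p.+3 C => u.2 Z0) (brac0 (v k.+1)).
    rewrite brE !ffunE => /eqP; rewrite mulf_eq0 signr_eq0 subr_eq0 /=.
    by move=> /eqP.
  (* Moving one full turn ahead writes the vertex 0 too as a successor. *)
  have -> : y = v (y + p.+2).+1 by rewrite -addnS vper /v valZpK.
  by rewrite brE cper subrr mulr0; apply: graph_lie_eq.
split.
  move=> /factP[a2 /centralP cper]; split=> //.
  have cb k : c k = c (odd k).
    by elim/ltn_ind: k => -[|[|k]] IH //; rewrite cper IH //= negbK.
  have cn k : c (k + p.+3)%N = (-1) ^+ num_opposite G * c k.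
    by rewrite /c vper flipsD exprD (mulrC (_ ^+ flips _ _)) mulrA.
  exists c; split=> [b | i]; last by rewrite -cb -aE /v valZpK.
  by rewrite -cn [RHS]cb oddD oddb.
move=> [a2 [d [dn aiE]]]; apply/factP; split=> //; apply/centralP.
have cd k : c k = d (odd k).
  rewrite /c.
  suff -> : a.1 (v k) = (-1) ^+ flips G k * d (odd k) by rewrite sgnK.
  pose f j : R := (-1) ^+ flips G j * d (odd j).
  rewrite aiE -[RHS]/(f k) (@periodic_modn _ p.+3 f) // => j.
  by rewrite /f flipsD oddD dn exprD -mulrA sgnK.
by move=> k; rewrite !cd /= negbK.
Qed.

(** * Signed sums of vertices *)

Definition signed_sum (R : realType) (n : nat) (C : finType) (P : pred 'I_n)
    (eps : 'I_n -> bool) : graph_lie R 'I_n C :=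
  \sum_(i < n | P i) (-1) ^+ eps i *: vvec R C i.

Lemma signed_sum1 (R : realType) (n : nat) (C : finType) (P : pred 'I_n) eps i :
  (signed_sum R C P eps).1 i = if P i then (-1) ^+ eps i else 0.
Proof.
rewrite /signed_sum (raddf_sum (@fst _ _)) sum_ffunE.
rewrite (eq_bigr (fun j => if j == i then (-1) ^+ eps j else 0)); last first.
  by move=> j _; rewrite !ffunE eq_sym; case: eqP => _; [exact: mulr1|exact: mulr0].
rewrite -big_mkcondr; case: ifP => Pi.
  by rewrite (big_pred1 i) // => j; rewrite andbC /=; case: eqP => // ->.
by rewrite big1 // => j /andP[Pj /eqP ji]; move: Pi; rewrite -ji Pj.
Qed.

Lemma signed_sum2 (R : realType) (n : nat) (C : finType) (P : pred 'I_n) eps :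
  (signed_sum R C P eps).2 = 0.
Proof.
by rewrite /signed_sum (raddf_sum (@snd _ _)) big1 // => i _; exact: scaler0.
Qed.

Theorem proposition4p3 (R : realType) (n : nat) (C : finType)
    (G : edge_labeled_graph 'I_n C) (m : nat) (A : {vspace graph_lie R 'I_n C})
    (n_ge3 : (3 <= n)%N) (G_cycle : directed_cycle G)
    (G_same : same_labels G) (m_def : m = num_opposite G)
    (A_factor : is_abelian_factor G A) :
  [/\ (~~ odd n -> odd m -> \dim A = 0%N),
      (~~ odd n -> ~~ odd m ->
         \dim A = 2%N /\
         exists eps : 'I_n -> bool,
           basis_of A
             [:: \sum_(i < n | odd i.+1) (-1) ^+ eps i *: vvec R C i;
                 \sum_(i < n | ~~ odd i.+1) (-1) ^+ eps i *: vvec R C i])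
    & (odd n ->
         \dim A = 1%N /\
         exists eps : 'I_n -> bool,
           basis_of A [:: \sum_(i < n) (-1) ^+ eps i *: vvec R C i])].
Proof.
case: n n_ge3 G A G_cycle G_same m_def A_factor => [|[|[|p]]] // _ G A cG sL mE fA.
have AP := cycle_factorP cG sL fA; rewrite -mE in AP.
have basis_dim X : basis_of A X -> \dim A = size X by case/andP=> /eqP <- /eqP.
have fst_neq0 (i : 'I_p.+3) (u : graph_lie R 'I_p.+3 C) : u.1 i != 0 -> u != 0.
  by apply: contraNneq => ->; rewrite ffunE.
split=> [n_even m_odd | n_even m_even | n_odd].
- apply/eqP; rewrite dimv_eq0 -subv0; apply/subvP => a /AP[a2 [c [cn aE]]].
  rewrite memv0; apply/eqP; apply: graph_lie_eq => //; apply/ffunP => i.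
  have := cn (odd i); rewrite (negPf n_even) addbF -signr_odd m_odd mulN1r.
  move=> /eqP; rewrite -addr_eq0 -mulr2n mulrn_eq0 /= => /eqP ci.
  by rewrite aE ci mulr0 ffunE.
- pose eps (i : 'I_p.+3) := odd (flips G i).
  (* [u true] is the sum over [v_1, v_3, ...], whose ordinals are even. *)
  pose u b := signed_sum R C (fun i : 'I_p.+3 => odd i.+1 == b) eps.
  have uA b : u b \in A.
    apply/AP; split; first exact: signed_sum2.
    exists (fun b' => (~~ b' == b)%:R); split=> [b' | i].
      by rewrite (negPf n_even) addbF -signr_odd (negPf m_even) mul1r.
    rewrite signed_sum1 /= signr_odd.
    by case: (_ == b); rewrite ?mulr1 ?mulr0.
  have u1E b i : (u b).1 i = if odd i.+1 == b then (-1) ^+ eps i else 0.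
    exact: signed_sum1.
  have bas : basis_of A [:: u true; u false].
    apply/andP; split.
      rewrite eqEsubv; apply/andP; split.
        by apply/span_subvP => x; rewrite !inE => /orP[] /eqP->; apply: uA.
      apply/subvP => a /AP[a2 [c [_ aE]]].
      have -> : a = c false *: u true + c true *: u false.
        apply: graph_lie_eq.
          apply/ffunP => i; rewrite !ffunE !u1E aE /= signr_odd.
          case: (odd i) => /=.
            by rewrite [_ *: 0]mulr0 add0r [_ *: _]mulrC.
          by rewrite [_ *: 0]mulr0 addr0 [_ *: _]mulrC.
        by rewrite a2 /= !signed_sum2 !scaler0 addr0.
      by apply: memvD; apply/memvZ/memv_span; rewrite !inE eqxx ?orbT.
    rewrite free_cons span_seq1 seq1_free; apply/andP; split.
      apply/vlineP => -[k /(congr1 (fun w : graph_lie R 'I_p.+3 C => w.1 ord0))].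
      rewrite ffunE !u1E /= [_ *: _]mulr0 => /eqP; by rewrite signr_eq0.
    by apply: (@fst_neq0 (inZp 1)); rewrite u1E signr_eq0.
  split; first exact: basis_dim bas.
  exists eps; congr (is_true (basis_of A _)) : bas.
  congr [:: _; _]; apply: eq_bigl => i; [exact: eqb_id | exact: eqbF_neg].
- (* The summand [m * odd i] encodes the relation [c_1 = (-1)^m c_0]. *)
  pose eps (i : 'I_p.+3) := odd (flips G i + m * odd i).
  pose u := signed_sum R C predT eps.
  have u1E i : u.1 i = (-1) ^+ flips G i * (-1) ^+ (m * odd i).
    by rewrite signed_sum1 signr_odd exprD.
  have bas : basis_of A [:: u].
    apply/andP; split; last first.
      by rewrite seq1_free (fst_neq0 ord0) // signed_sum1 signr_eq0.
    rewrite span_seq1 eqEsubv; apply/andP; split.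
      apply/AP; split; first exact: signed_sum2.
      exists (fun b => (-1) ^+ (m * b)); split=> // b.
      rewrite n_odd addbT; case: b; rewrite /= ?muln0 ?muln1 ?mulr1 //.
      by rewrite -expr2 sqrr_sign.
    apply/subvP => a /AP[a2 [c [cn aE]]].
    apply/vlineP; exists (c false); apply: graph_lie_eq.
      apply/ffunP => i; rewrite ffunE u1E aE [_ *: _]mulrC -mulrA.
      congr (_ * _); case: (odd i); rewrite ?muln0 ?mul1r // muln1 -cn n_odd.
      by [].
    by rewrite a2 /= signed_sum2 scaler0.
  split; first exact: basis_dim bas.
  by exists eps.
Qed.
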